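(* Let $G$ be a finite, simple, $2$-edge-connected, claw-free cubic graph with $n(G)=|V(G)|$ vertices. If $G$ is not a ring of diamonds, then $Z_{\dot{\ell}}(G)\le Z(G)\le \left\lceil \frac{5n(G)}{18}\right\rceil+1$. If $G$ is a ring of diamonds, then $Z_{\dot{\ell}}(G)=Z(G)=\frac{n(G)}{4}+2$.
   Context: Zero forcing: given $S\subseteq V(G)$, color the vertices of $S$ blue and all others white; repeatedly apply the rule ''if $w$ is the only white neighbor of a blue vertex $v$, color $w$ blue''. $S$ is a zero forcing set if eventually all vertices are blue; $Z(G)$ is the minimum size of a zero forcing set. Loop zero forcing (for connected simple graphs): same process, but the rule is ''color $w$ blue if either $w$ is the only white neighbor of some blue vertex $v$, or every neighbor of $w$ is blue''; $Z_{\dot{\ell}}(G)$ is the minimum size of a set from which this process turns all vertices blue. A graph is claw-free if it has no induced $K_{1,3}$. A diamond is the graph obtained from $K_4$ by deleting one edge; it has exactly two vertices of degree $2$. A ring of diamonds is a cubic graph obtained from $k\ge 2$ vertex-disjoint diamonds $D_1,\dots,D_k$ by joining, for each $i\in[k]$ (indices mod $k$), one degree-$2$ vertex of $D_i$ to one degree-$2$ vertex of $D_{i+1}$, so that each degree-$2$ vertex of each diamond receives exactly one such new edge. *)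

(* Defs.v *)
From mathcomp Require Import all_boot all_order all_algebra.

Set Implicit Arguments.
Unset Strict Implicit.
Unset Printing Implicit Defensive.

(* A finite simple graph is a symmetric irreflexive [e : rel T] on a finType. *)

Section Graphs.

Variables (T : finType) (e : rel T).

Definition nbhd (v : T) : {set T} := [set w | e v w].

Definition cubic : Prop := forall v, #|nbhd v| = 3.

Definition claw (c x y z : T) : bool :=
  [&& uniq [:: c; x; y; z], e c x, e c y, e c z,
      ~~ e x y, ~~ e x z & ~~ e y z].

Definition claw_free : Prop := forall c x y z, ~~ claw c x y z.

Definition connected_graph (r : rel T) : Prop := forall x y, connect r x y.

Definition del_edge (u v : T) : rel T :=
  [rel x y | e x y && ([set x; y] != [set u; v])].

Definition two_edge_connected : Prop :=
  [/\ 1 < #|T|, connected_graph e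
    & forall u v, e u v -> connected_graph (del_edge u v)].

(* [A] induces K_4 minus the edge [ab], so [a] and [b] are its two vertices   *)
(* of degree 2.                                                               *)
Definition diamond (A : {set T}) (a b : T) : Prop :=
  [/\ #|A| = 4, a \in A, b \in A, a != b
    & {in A &, forall x y, e x y = (x != y) && ([set x; y] != [set a; b])}].

(* [b i] is the degree-2 vertex of [D i] joined to [D (i + 1)], and [a i] the *)
(* one joined to [D (i - 1)]; they differ because each degree-2 vertex        *)
(* receives exactly one new edge.  [ordS] is the successor mod [k].           *)
Definition ring_of_diamonds : Prop :=
  exists (k : nat) (D : 'I_k -> {set T}) (a b : 'I_k -> T),
    [/\ 2 <= k,
        forall i j, i != j -> [disjoint D i & D j],
        \bigcup_i D i = [set: T],
        forall i, diamond (D i) (a i) (b i)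
      & forall i j x y, i != j -> x \in D i -> y \in D j ->
          e x y = [exists l, [set x; y] == [set b l; a (ordS l)]]].

(* A colour-change rule [rule S w] says that, [S] being the set of blue       *)
(* vertices, the white vertex [w] may be coloured blue.                       *)
Definition color_step (rule : {set T} -> pred T) : rel {set T} :=
  [rel S S' | [exists w, rule S w && (S' == w |: S)]].

Definition forcing_set (rule : {set T} -> pred T) (S : {set T}) : bool :=
  connect (color_step rule) S [set: T].

(* The default [set: T] is itself a forcing set, for any rule. *)
Definition forcing_number (rule : {set T} -> pred T) : nat :=
  #|[arg min_(S < [set: T] | forcing_set rule S) #|S|]|.

Definition zf_rule (S : {set T}) (w : T) : bool :=
  [exists v in S, nbhd v :\: S == [set w]].

Definition loop_zf_rule (S : {set T}) (w : T) : bool :=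
  zf_rule S w || (w \notin S) && (nbhd w \subset S).

Definition zf_number : nat := forcing_number zf_rule.

Definition loop_zf_number : nat := forcing_number loop_zf_rule.

End Graphs.

(* Main.v *)
(** An edge of a claw-free cubic graph other than K4 is inner if its ends have
    a common neighbour; every vertex has at most one other ("outer") edge, and
    the components of the inner edges, called units, are triangles and
    diamonds.  Colour the units one at a time.  A unit entered through one outer
    edge is forced at the cost of one extra blue vertex, and a triangle entered
    through two outer edges is free; counting outer edges, this costs at most
    one vertex out of four as long as every unit but the last also has an exit.
    Such an order exists because no unit disconnects the graph: cutting off each
    side would take two outer edges, but a unit has at most three.  The first
    and last units account for a constant, so that 4 Z <= n + 8 for every such
    graph, which is stronger than the bound with 5/18.

    In a ring of k diamonds, the two middle vertices of each diamond are twins,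
    so a loop forcing set meets each of the k pairs; a set with at most k + 1
    vertices that does so allows no move at all. *)

Require Import Defs.
From mathcomp Require Import all_boot all_order all_algebra.
From mathcomp Require Import zify.

Set Implicit Arguments.
Unset Strict Implicit.
Unset Printing Implicit Defensive.

Import Order.TTheory GRing.Theory Num.Theory.

(** * Auxiliary facts on lists, reachability and counting *)

Lemma uniq3_perm (T : eqType) (x y z : T) :
  uniq [:: x; y; z] -> uniq [:: y; x; z] /\ uniq [:: z; x; y].
Proof.
by rewrite /= !inE !negb_or !andbT ![_ == x]eq_sym [z == y]eq_sym => /andP[/andP[-> ->] ->].
Qed.

Lemma connect_stable (T : finType) (r : rel T) (L : {set T}) x y :
  (forall u v, r u v -> u \in L -> v \in L) -> connect r x y ->
  x \in L -> y \in L.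
Proof.
move=> rL /connectP[p]; elim: p x => [|u p IHp] x /=; first by move=> _ ->.
by case/andP=> rxu /IHp IH /IH yL /(rL _ _ rxu).
Qed.

Lemma card_set_seq (T : finType) (U : {set T}) (s : seq T) (P : pred T) :
  U =i s -> uniq s -> #|[set x in U | P x]| = count P s.
Proof.
move=> EU s_uniq; rewrite -size_filter -(card_uniqP (filter_uniq P s_uniq)).
by apply: eq_card => x; rewrite !inE EU mem_filter andbC.
Qed.

(** * Forcing numbers, and forcing expressed through closed sets *)

Section ForcingNumbers.

Variables (T : finType) (e : rel T).

Lemma forcing_numberP (rule : {set T} -> pred T) :
  exists2 S, forcing_set rule S & forcing_number rule = #|S|.
Proof.
rewrite /forcing_number; case: arg_minnP => [|S S_forcing _]; last by exists S.
exact: connect0.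
Qed.

Lemma forcing_number_le (rule : {set T} -> pred T) (S : {set T}) :
  forcing_set rule S -> forcing_number rule <= #|S|.
Proof.
rewrite /forcing_number; case: arg_minnP => [|S' _ S'min /S'min//].
exact: connect0.
Qed.

Lemma loop_zf_number_le : loop_zf_number e <= zf_number e.
Proof.
rewrite /loop_zf_number /zf_number; have [S S_forcing ->] := forcing_numberP (zf_rule e).
apply: forcing_number_le; move: S_forcing; rewrite /forcing_set.
apply: connect_sub => S1 S2 /existsP[w /andP[Sw eqS]].
by apply/connect1/existsP; exists w; rewrite /loop_zf_rule Sw.
Qed.

Definition zf_closed (S : {set T}) : Prop := forall v w,
  v \in S -> e v w -> (forall y, e v y -> y != w -> y \in S) -> w \in S.

(** The final blue set of the process started from [B] is the least closed set containing [B], so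
    this says that [B] eventually colours [X], without fixing an order of moves. *)
Definition forces (B X : {set T}) : Prop :=
  forall S : {set T}, B \subset S -> zf_closed S -> X \subset S.

(** A largest set reachable from [B] is closed, since any remaining move would enlarge it; by
    hypothesis it is then everything. *)
Lemma forces_forcing_set B : forces B setT -> forcing_set (zf_rule e) B.
Proof.
move=> B_T; pose P (S : {set T}) := (B \subset S) && connect (color_step (zf_rule e)) B S.
have PB: P B by rewrite /P subxx connect0.
case: (arg_maxnP (fun S : {set T} => #|S|) PB) => S /andP[BS cBS] Smax.
suff S_closed: zf_closed S.
  by move: (B_T S BS S_closed); rewrite subTset => /eqP ST; rewrite /forcing_set -ST.
move=> v w vS vw others; apply: contraT => wS.
have /Smax: P (w |: S); last by rewrite /= cardsU1 wS ltnn.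
rewrite /P (subset_trans BS (subsetUr _ _)).
apply: connect_trans cBS (connect1 _); apply/existsP; exists w.
rewrite eqxx andbT; apply/existsP; exists v; rewrite vS /=.
apply/eqP/setP => y; rewrite !inE; apply/andP/eqP => [[yS vy]|->//].
by apply/eqP; apply: contraNT yS => /(others _ vy).
Qed.

End ForcingNumbers.

(** * Inner and outer edges *)

Section ClawFreeCubic.

Variables (T : finType) (e : rel T).
Hypotheses (e_sym : symmetric e) (e_irr : irreflexive e).
Hypotheses (e_cf : claw_free e) (e_cubic : cubic e).

Definition inner : rel T := [rel x y | e x y && [exists z, e x z && e y z]].

(* Junk value [x] when [x] has no outer neighbour. *)
Definition outer x := odflt x [pick y | e x y && ~~ inner x y].

Definition nbhd3 (v x y z : T) : Prop :=
  uniq [:: v; x; y; z] /\ forall w, e v w = (w \in [:: x; y; z]).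

Lemma adj_neq x y : e x y -> x != y.
Proof. by apply: contraTneq => ->; rewrite e_irr. Qed.

Lemma third_nbr v x y : e v x -> e v y -> x != y -> exists z, nbhd3 v x y z.
Proof.
move=> vx vy neq_xy.
have sub: [set x; y] \subset nbhd e v.
  by apply/subsetP => w; rewrite !inE => /orP[] /eqP->.
have /cards1P[z Ez]: #|nbhd e v :\: [set x; y]| == 1.
  by rewrite cardsD (setIidPr sub) e_cubic cards2 neq_xy.
have: z \in nbhd e v :\: [set x; y] by rewrite Ez set11.
rewrite !inE negb_or => /andP[/andP[zx zy] vz]; exists z; split.
  rewrite /= !inE !negb_or neq_xy (adj_neq vx) (adj_neq vy) (adj_neq vz).
  by rewrite eq_sym zx eq_sym zy.
move=> w; have /setP/(_ w) := Ez; rewrite !inE orbA.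
by case: (w == x) /eqP => [->|_] //; case: (w == y) /eqP => [->|_].
Qed.

Lemma nbhd3C v x y z : nbhd3 v x y z -> nbhd3 v y x z.
Proof.
case=> u_vxyz Ev; split; last by move=> w; rewrite Ev !inE orbCA.
by rewrite -(perm_uniq (s1 := [:: v; x; y; z])) // perm_cons (perm_catCA [:: x] [:: y]).
Qed.

Lemma inner_adj x y : inner x y -> e x y.
Proof. by case/andP. Qed.

Lemma inner_sym : symmetric inner.
Proof.
move=> x y; rewrite /inner /= e_sym; congr (_ && _).
by apply: eq_existsb => z; rewrite andbC.
Qed.

Lemma inner_common x y z : e x y -> e x z -> e y z -> inner x y.
Proof. by move=> xy xz yz; rewrite /inner /= xy; apply/existsP; exists z; rewrite xz. Qed.

(** With the third neighbour [w], the vertices [y], [z], [w] would be the leaves of a claw at [x]: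
    an edge between two of them would put [x y] or [x z] in a triangle. *)
Lemma outer_nbr_unique x y z :
  e x y -> ~~ inner x y -> e x z -> ~~ inner x z -> y = z.
Proof.
move=> xy ixy xz ixz; apply/eqP/idPn => neq_yz.
have [w [u_xyzw Ex]] := third_nbr xy xz neq_yz.
have xw: e x w by rewrite Ex !inE eqxx !orbT.
have /negP[] := e_cf x y z w; rewrite /claw u_xyzw xy xz xw /=.
rewrite -!negb_or; apply/or3P => -[] adj.
- by rewrite (inner_common xy xz adj) in ixy.
- by rewrite (inner_common xy xw adj) in ixy.
by rewrite (inner_common xz xw adj) in ixz.
Qed.

Lemma outerP x y : e x y -> ~~ inner x y -> outer x = y.
Proof.
move=> xy ixy; rewrite /outer; case: pickP => [z /andP[xz ixz]|/(_ y)].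
  exact: outer_nbr_unique xz ixz xy ixy.
by rewrite xy ixy.
Qed.

Lemma outer_adj x : outer x != x -> e x (outer x) && ~~ inner x (outer x).
Proof. by rewrite /outer; case: pickP => [z|] //=; rewrite eqxx. Qed.

(** The outer edges form a matching, and vertices without an outer edge are fixed points.
    Injectivity of [outer] later drives the counting of cut edges. *)
Lemma outerK : involutive outer.
Proof.
move=> x; have [Ex|/outer_adj/andP[adj nadj]] := eqVneq (outer x) x; first by rewrite !Ex.
by apply: outerP; rewrite 1?e_sym // inner_sym.
Qed.

Lemma adj_outer x y : e x y -> inner x y \/ outer x = y.
Proof. by move=> xy; case: (boolP (inner x y)) => [|/(outerP xy)]; [left|right]. Qed.

Lemma nbhd3_outer v x y z : nbhd3 v x y z -> ~~ e x z -> ~~ e y z -> outer v = z.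
Proof.
case=> _ Ev xz yz; have vz: e v z by rewrite Ev !inE eqxx !orbT.
apply: outerP => //; apply/negP => /andP[_ /existsP[w]].
rewrite Ev !inE => /andP[/or3P[]/eqP-> ]; rewrite 1?e_sym.
- by rewrite (negPf xz).
- by rewrite (negPf yz).
by rewrite e_irr.
Qed.

Lemma nbhd3_outer_id v x y z : nbhd3 v x y z -> e x y -> e x z -> outer v = v.
Proof.
move=> vN xy xz; case: (vN) => _ Ev; apply: contraTeq (xy) => /outer_adj.
have [vx vy vz]: [/\ e v x, e v y & e v z] by rewrite !Ev !inE !eqxx !orbT.
case/andP=> vo /negP[]; move: vo; rewrite Ev !inE => /or3P[]/eqP->.
- exact: inner_common xy.
- by apply: inner_common vx _ => //; rewrite e_sym.
by apply: inner_common vx _ => //; rewrite e_sym.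
Qed.

(** * Units: triangles, diamonds and K4 *)

Variant unit_shape (U : {set T}) : Prop :=
| Triangle x y z x' y' z' of
    U =i [:: x; y; z] & nbhd3 x y z x' & nbhd3 y x z y' & nbhd3 z x y z'
  & uniq [:: x'; y'; z']
| Diamond a b c d a' b' of
    U =i [:: a; b; c; d] & nbhd3 c d a b & nbhd3 d c a b
  & nbhd3 a c d a' & nbhd3 b c d b' & a' != b
| Complete a b c d of
    U =i [:: a; b; c; d]
  & nbhd3 a b c d & nbhd3 b a c d & nbhd3 c a b d & nbhd3 d a b c.

(** Claw-freeness puts [v] in a triangle, and the third neighbours of its vertices decide the shape:
    all equal gives K4, exactly two equal a diamond, all distinct a triangle. The side conditions of
    [unit_shape] keep the cases apart; for instance [a' != b] says that the ends of a diamond are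
    not adjacent. *)
Lemma unit_exists v : exists2 U : {set T}, v \in U & unit_shape U.
Proof.
have [x [y [vx vy xy]]]: exists x y, [/\ e v x, e v y & e x y].
  have /card_gt0P[x]: 0 < #|nbhd e v| by rewrite e_cubic.
  have /card_gt0P[y]: 0 < #|nbhd e v :\ x|.
    by have := cardsD1 x (nbhd e v); rewrite e_cubic; case: (_ \in _) => /=; lia.
  rewrite !inE => /andP[yx vy] vx; rewrite eq_sym in yx.
  have [z [u_vxyz Ev]] := third_nbr vx vy yx.
  have vz: e v z by rewrite Ev !inE eqxx !orbT.
  case xy: (e x y); first by exists x, y.
  case xz: (e x z); first by exists x, z.
  case yz: (e y z); first by exists y, z.
  by have := e_cf v x y z; rewrite /claw u_vxyz vx vy vz xy xz yz.
have [xv yv yx]: [/\ e x v, e y v & e y x] by rewrite !(e_sym _ v) (e_sym y).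
have nxy := adj_neq xy; have nvx := adj_neq vx; have nvy := adj_neq vy.
have [z vN] := third_nbr vx vy nxy.
have [x' xN] := third_nbr xv xy nvy.
have [y' yN] := third_nbr yv yx nvx.
have third u a b c : nbhd3 u a b c -> e c u.
  by case=> _ Eu; rewrite e_sym Eu !inE eqxx !orbT.
have zv := third _ _ _ _ vN; have xx := third _ _ _ _ xN; have yy := third _ _ _ _ yN.
(* Two equal third neighbours make their owners the middle vertices of a diamond; the ends are the
   shared neighbour and the remaining triangle vertex. *)
have [Ex|nx] := eqVneq z x'; have [Ey|ny] := eqVneq z y'.
- subst x' y'; exists [set w in [:: v; x; y; z]]; first by rewrite !inE eqxx.
  apply: (@Complete _ v x y z) => //; first exact: in_set; have [w zN] := third_nbr zv xx nvx.
  have Ew: w = y.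
    move: yy; case: (zN) => _ ->; rewrite !inE (negPf (adj_neq yv)).
    by rewrite (negPf (adj_neq yx)) => /eqP.
  by rewrite -Ew.
- subst x'; have [w zN] := third_nbr zv xx nvx.
  exists [set w in [:: y; z; v; x]]; first by rewrite !inE eqxx !orbT.
  by apply: Diamond (in_set _) vN xN yN zN _; rewrite eq_sym.
- subst y'; have [w zN] := third_nbr zv yy nvy.
  exists [set w in [:: x; z; v; y]]; first by rewrite !inE eqxx !orbT.
  by apply: Diamond (in_set _) (nbhd3C vN) yN xN zN _; rewrite eq_sym.
have [Exy|nxy'] := eqVneq x' y'.
  subst y'; have [w zN] := third_nbr xx yy nxy.
  exists [set w in [:: v; x'; x; y]]; first by rewrite !inE eqxx.
  by apply: Diamond (in_set _) (nbhd3C xN) (nbhd3C yN) vN zN _.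
exists [set w in [:: v; x; y]]; first by rewrite !inE eqxx.
by apply: Triangle (in_set _) vN xN yN _; rewrite /= !inE negb_or nx ny nxy'.
Qed.

Lemma nbhd3R v x y z : nbhd3 v x y z -> nbhd3 v x z y.
Proof.
case=> u_vxyz Ev; split; last by move=> w; rewrite Ev !inE (orbC (w == y)).
by rewrite -(perm_uniq (s1 := [:: v; x; y; z])) // !perm_cons (perm_catC [:: y]).
Qed.

Lemma nbhd3_adj v x y z : nbhd3 v x y z -> [/\ e v x, e v y & e v z].
Proof. by case=> _ Ev; rewrite !Ev !inE !eqxx !orbT. Qed.

Lemma nbhd3_neq v x y z :
  nbhd3 v x y z -> [/\ v != x, v != y & v != z] /\ [/\ x != y, x != z & y != z].
Proof.
by case=> /=; rewrite !inE !negb_or => /and4P[/and3P[? ? ?] /andP[? ?] ? _] _; split.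
Qed.

Lemma triangle_outer x y z x' y' z' :
  nbhd3 x y z x' -> nbhd3 y x z y' -> nbhd3 z x y z' -> uniq [:: x'; y'; z'] ->
  outer x = x'.
Proof.
move=> xN yN zN; rewrite /= !inE negb_or => /and3P[/andP[xy xz] _ _].
have [[_ _ nx] [_ ny nz]] := nbhd3_neq xN.
apply: nbhd3_outer xN _ _.
  by case: yN => _ ->; rewrite !inE !negb_or eq_sym nx eq_sym nz.
by case: zN => _ ->; rewrite !inE !negb_or eq_sym nx eq_sym ny.
Qed.

Lemma diamond_uniq a b c d : nbhd3 c d a b -> uniq [:: a; b; c; d].
Proof.
by case=> u_cdab _; rewrite -(perm_uniq (s1 := [:: c; d; a; b])) // (perm_catC [:: c; d]).
Qed.

Lemma diamond_outer a b c d a' :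
  nbhd3 c d a b -> nbhd3 d c a b -> nbhd3 a c d a' -> a' != b -> outer a = a'.
Proof.
move=> cN dN aN nb; have [[_ _ na] [_ nc nd]] := nbhd3_neq aN.
apply: nbhd3_outer aN _ _.
  by case: cN => _ ->; rewrite !inE !negb_or nb eq_sym nd eq_sym na.
by case: dN => _ ->; rewrite !inE !negb_or nb eq_sym nc eq_sym na.
Qed.

Lemma diamond_end_neq a b c d a' b' :
  nbhd3 c d a b -> nbhd3 d c a b -> nbhd3 a c d a' -> nbhd3 b c d b' ->
  a' != b -> b' != a.
Proof.
move=> cN dN aN bN; apply: contraNneq => Eb'; move: bN; rewrite Eb' => bN.
have [_ _] := nbhd3_adj bN; rewrite e_sym; case: (aN) => _ ->.
have [[_ _ cb] _] := nbhd3_neq cN; have [[_ _ db] _] := nbhd3_neq dN.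
by rewrite !inE ![b == _]eq_sym (negPf cb) (negPf db).
Qed.

Lemma diamond_middle c d a b :
  nbhd3 c d a b -> nbhd3 d c a b -> outer c = c.
Proof. by move=> cN /nbhd3_adj[_ da db]; apply: nbhd3_outer_id cN da db. Qed.

(** * Components of the inner edges, and their unions, the inner-closed sets *)

Definition inner_closed (L : {set T}) : Prop :=
  forall x y, inner x y -> x \in L -> y \in L.

Definition comp (u : T) : {set T} := [set w | connect inner u w].

Lemma comp_refl u : u \in comp u.
Proof. by rewrite inE connect0. Qed.

Lemma comp_closed u : inner_closed (comp u).
Proof. by move=> x y xy; rewrite !inE => /connect_trans-> //; apply: connect1. Qed.

Lemma comp_sub L u : inner_closed L -> u \in L -> comp u \subset L.
Proof.
by move=> cL uL; apply/subsetP => w; rewrite inE => /connect_stable; apply.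
Qed.

Lemma connect_innerC : connect_sym inner.
Proof. exact: sym_connect_sym inner_sym. Qed.

Lemma mem_comp u v : (u \in comp v) = (v \in comp u).
Proof. by rewrite !inE connect_innerC. Qed.

Lemma compU_closed X u : inner_closed X -> inner_closed (X :|: comp u).
Proof.
move=> cX x y xy; rewrite !in_setU => /orP[xX|xu]; apply/orP.
  by left; apply: cX xX.
by right; apply: comp_closed xu.
Qed.

Lemma setC_closed X : inner_closed X -> inner_closed (~: X).
Proof.
move=> cX x y xy; rewrite !inE; apply: contraNN; apply: cX.
by rewrite inner_sym.
Qed.

Lemma inner_outer x y : inner x y -> outer x != y.
Proof.
move=> xy; apply/eqP => Exy; have := inner_adj xy => /adj_neq.
by rewrite eq_sym -Exy => /outer_adj; rewrite Exy xy andbF.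
Qed.

Lemma nbhd3_inner v x y z w :
  nbhd3 v x y z -> outer v = z -> inner v w -> w \in [:: x; y].
Proof.
case=> _ Ev Ez vw; have := inner_adj vw; rewrite Ev !inE orbA -Ez.
by rewrite [w == outer v]eq_sym (negPf (inner_outer vw)) orbF.
Qed.

Lemma mem_seq_connect (h : T) (s : seq T) w :
  all (inner h) s -> w \in h :: s -> w \in comp h.
Proof.
move/allP=> hs; rewrite in_cons => /predU1P[->|/hs hw]; first exact: comp_refl.
by rewrite inE connect1.
Qed.

(** A triangle vertex or a diamond end has only one neighbour that may lie outside, and it is its
    outer one; all other vertices of a unit have their three neighbours inside. *)
Lemma unit_shape_closed U : unit_shape U -> inner_closed U.
Proof.
case=> [x y z x' y' z' EU xN yN zN u'|a b c d a' b' EU cN dN aN bN nab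
       |a b c d EU aN bN cN dN] v w vw; rewrite !EU.
- have [uy uz] := uniq3_perm u'.
  have Ex := triangle_outer xN yN zN u'.
  have Ey := triangle_outer yN xN (nbhd3C zN) uy.
  have Ez := triangle_outer zN (nbhd3C xN) (nbhd3C yN) uz.
  rewrite !in_cons in_nil !orbF => /or3P[]/eqP Ev; subst v.
  + by have := nbhd3_inner xN Ex vw; rewrite !inE => /orP[]->; rewrite ?orbT.
  + by have := nbhd3_inner yN Ey vw; rewrite !inE => /orP[]->; rewrite ?orbT.
  by have := nbhd3_inner zN Ez vw; rewrite !inE => /orP[]->; rewrite ?orbT.
- have Ea := diamond_outer cN dN aN nab.
  have Eb := diamond_outer (nbhd3R cN) (nbhd3R dN) bN (diamond_end_neq cN dN aN bN nab).
  have vw' := inner_adj vw.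
  rewrite !in_cons !in_nil !orbF => /or4P[]/eqP Ev; subst v.
  + by have := nbhd3_inner aN Ea vw; rewrite !inE => /orP[]->; rewrite ?orbT.
  + by have := nbhd3_inner bN Eb vw; rewrite !inE => /orP[]->; rewrite ?orbT.
  + by move: vw'; case: cN => _ ->; rewrite !inE => /or3P[]->; rewrite ?orbT.
  by move: vw'; case: dN => _ ->; rewrite !inE => /or3P[]->; rewrite ?orbT.
have vw' := inner_adj vw.
rewrite !in_cons !in_nil !orbF => /or4P[]/eqP Ev; subst v; move: vw'.
- by case: aN => _ ->; rewrite !inE => /or3P[]->; rewrite ?orbT.
- by case: bN => _ ->; rewrite !inE => /or3P[]->; rewrite ?orbT.
- by case: cN => _ ->; rewrite !inE => /or3P[]->; rewrite ?orbT.
by case: dN => _ ->; rewrite !inE => /or3P[]->; rewrite ?orbT.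
Qed.

Lemma unit_shape_hub U : unit_shape U -> exists h, U \subset comp h.
Proof.
case=> [x y z x' y' z' EU xN yN zN u'|a b c d a' b' EU cN dN aN bN nab
       |a b c d EU aN bN cN dN].
- exists x; apply/subsetP => w; rewrite EU; apply: mem_seq_connect.
  have [xy xz _] := nbhd3_adj xN; have [_ yz _] := nbhd3_adj yN.
  by rewrite /= (inner_common xy xz yz) (inner_common xz xy) // e_sym.
- exists c; apply/subsetP => w; rewrite EU => w_in.
  apply: (@mem_seq_connect _ [:: d; a; b]); last first.
    by move: w_in; rewrite !inE => /or4P[]->; rewrite ?orbT.
  have [cd ca cb] := nbhd3_adj cN; have [_ da db] := nbhd3_adj dN.
  by rewrite /= (inner_common cd ca da) (inner_common ca cd) ?(inner_common cb cd) // e_sym.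
exists a; apply/subsetP => w; rewrite EU; apply: mem_seq_connect.
have [ab ac ad] := nbhd3_adj aN; have [_ bc bd] := nbhd3_adj bN.
by rewrite /= (inner_common ab ac bc) (inner_common ac ab) ?(inner_common ad ab) // e_sym.
Qed.

(** A unit around [u] is inner-closed, so it contains [comp u]; its hub reaches all of it by inner
    edges, so it contains nothing more. *)
Lemma comp_shape u : unit_shape (comp u).
Proof.
have [U uU U_unit] := unit_exists u; suff <-: U = comp u by [].
apply/eqP; rewrite eqEsubset (comp_sub (unit_shape_closed U_unit) uU) andbT.
have [h hU] := unit_shape_hub U_unit; have := subsetP hU u uU.
rewrite mem_comp => /(comp_sub (@comp_closed u)); exact: subset_trans hU.
Qed.

Lemma card_eq_seq (U : {set T}) (s : seq T) : U =i s -> uniq s -> #|U| = size s.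
Proof. by move=> EU /card_uniqP <-; apply: eq_card. Qed.

Lemma complete_outer a b c d :
  nbhd3 a b c d -> nbhd3 b a c d -> outer a = a.
Proof. by move=> aN /nbhd3_adj[_ bc bd]; apply: nbhd3_outer_id aN bc bd. Qed.

(** Middle vertices of a diamond and all vertices of K4 are fixed by [outer], which leaves at most
    3, 2 or 0 exits. *)
Lemma comp_outer_le3 u :
  #|[set w in comp u | outer w \notin comp u]| <= 3.
Proof.
case: (comp_shape u) => [x y z x' y' z' EU xN yN zN u'
    |a b c d a' b' EU cN dN aN bN nab|a b c d EU aN bN cN dN].
- have [[xy xz _] [yz _ _]] := nbhd3_neq xN.
  by rewrite (card_set_seq _ EU) ?count_size //= !inE negb_or xy xz yz.
- rewrite (card_set_seq _ EU) ?(diamond_uniq cN) //=.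
  rewrite (diamond_middle cN dN) (diamond_middle dN cN).
  have -> : c \in comp u by rewrite EU !inE eqxx !orbT.
  have -> : d \in comp u by rewrite EU !inE eqxx !orbT.
  by case: (outer a \in comp u); case: (outer b \in comp u).
rewrite (card_set_seq _ EU) /=; last by case: aN.
rewrite (complete_outer aN bN) (complete_outer bN aN).
rewrite (complete_outer cN (nbhd3C aN)) (complete_outer dN (nbhd3C (nbhd3R aN))).
by rewrite !EU !inE !eqxx !orbT.
Qed.

(** * The cost of colouring one unit *)

Lemma zf_closed_third S v x y z :
  zf_closed e S -> nbhd3 v x y z -> v \in S -> x \in S -> y \in S -> z \in S.
Proof.
move=> cS vN vS xS yS; have [_ _ vz] := nbhd3_adj vN.
apply: cS vS vz _ => w; case: vN => _ ->; rewrite !inE.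
by case/or3P=> /eqP-> //; rewrite eqxx.
Qed.

(** The other neighbours of [outer u] are joined to it by inner edges, hence lie in [X]. So a blue
    union of units forces across each of its outer edges. *)
Lemma zf_closed_outer (X S : {set T}) u :
  zf_closed e S -> inner_closed X -> X \subset S -> outer u \in X -> u \in S.
Proof.
move=> cS cX XS ouX; have [Eu|nou] := eqVneq (outer u) u; first by rewrite -Eu (subsetP XS).
have /andP[uo _] := outer_adj nou.
apply: (cS (outer u)); rewrite ?(subsetP XS) // 1?e_sym // => y /adj_outer[oy|].
  by rewrite (subsetP XS) // (cX _ _ oy).
by rewrite outerK => ->; rewrite eqxx.
Qed.

(** This counts the outer edges leaving [X], since each vertex has at most one; if [X] is
    inner-closed, no other edges leave it. *)
Definition boundary (X : {set T}) : nat := #|[set x in X | outer x \notin X]|.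

(* Each unit is paid for: [4 |A|] is at most [|U|] plus twice the increase of *)
(* the boundary, with a deficit of 4 only for a unit without exits.           *)
Definition affordable (X U : {set T}) : Prop :=
  exists A : {set T}, (forall B, forces e B X -> forces e (B :|: A) (X :|: U)) /\
    4 * #|A| + 2 * #|[set w in U | outer w \in X]|
      <= #|U| + 2 * #|[set w in U | outer w \notin X :|: U]|
         + 4 * (#|[set w in U | outer w \notin X :|: U]| == 0).

Lemma forces_unit (X U A : {set T}) :
  inner_closed X ->
  (forall S, zf_closed e S -> X \subset S -> A \subset S ->
     (forall u, outer u \in X -> u \in S) -> U \subset S) ->
  forall B, forces e B X -> forces e (B :|: A) (X :|: U).
Proof.
move=> cX AU B BX S; rewrite !subUset => /andP[BS AS] cS.
have XS := BX S BS cS; rewrite XS AU // => u; exact: zf_closed_outer cS cX XS.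
Qed.

(** Here [x] is forced from [x'], and then forces the last of [y], [z] once the other is blue. A
    second entrance makes this free; otherwise [y] is bought. For 1, 2, 3 entrances the inequality
    reads 6 <= 7, 4 <= 5, 6 <= 7. *)
Lemma affordable_triangle (X U : {set T}) x y z x' y' z' :
  inner_closed X -> [disjoint X & U] ->
  U =i [:: x; y; z] -> nbhd3 x y z x' -> nbhd3 y x z y' -> nbhd3 z x y z' ->
  uniq [:: x'; y'; z'] -> x' \in X -> affordable X U.
Proof.
move=> cX dXU EU xN yN zN u' x'X.
have [uy uz] := uniq3_perm u'.
have Ex := triangle_outer xN yN zN u'.
have Ey := triangle_outer yN xN (nbhd3C zN) uy.
have Ez := triangle_outer zN (nbhd3C xN) (nbhd3C yN) uz.
have uU : uniq [:: x; y; z].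
  by have [[xy xz _] [yz _ _]] := nbhd3_neq xN; rewrite /= !inE negb_or xy xz yz.
have x'U : x' \notin U by rewrite (disjointFr dXU).
have y'U : y' \notin U.
  have [[_ _ yy'] [_ xy' zy']] := nbhd3_neq yN.
  by rewrite EU !inE !negb_or ![y' == _]eq_sym xy' yy' zy'.
have z'U : z' \notin U.
  have [[_ _ zz'] [_ xz' yz']] := nbhd3_neq zN.
  by rewrite EU !inE !negb_or ![z' == _]eq_sym xz' yz' zz'.
rewrite /affordable !(card_set_seq _ EU) // (card_eq_seq EU) //=.
rewrite Ex Ey Ez !in_setU (negPf x'U) (negPf y'U) (negPf z'U) !orbF x'X /=.
have Us S : zf_closed e S -> x \in S -> (y \in S) || (z \in S) -> x' \in S -> U \subset S.
  move=> cS xS yzS x'S; have [yS zS]: y \in S /\ z \in S.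
    case/orP: yzS => [yS|zS]; split => //.
      by apply: zf_closed_third cS (nbhd3R xN) xS yS x'S.
    by apply: zf_closed_third cS (nbhd3R (nbhd3C xN)) xS zS x'S.
  by apply/subsetP => w; rewrite EU !inE => /or3P[] /eqP->.
case y'X: (y' \in X) => /=.
  exists set0; rewrite cards0; split; last by case: (z' \in X).
  apply: forces_unit cX _ => S cS XS _ oS.
  by apply: Us; rewrite ?(oS x) ?(oS y) ?Ex ?Ey //; apply: (subsetP XS).
case z'X: (z' \in X) => /=.
  exists set0; rewrite cards0; split=> //.
  apply: forces_unit cX _ => S cS XS _ oS.
  by apply: Us; rewrite ?(oS x) ?(oS z) ?Ex ?Ez ?orbT //; apply: (subsetP XS).
exists [set y]; rewrite cards1; split=> //.
apply: forces_unit cX _ => S cS XS; rewrite sub1set => yS oS.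
by apply: Us; rewrite ?(oS x) ?yS ?Ex //; apply: (subsetP XS).
Qed.

(** Only [c] is bought: [a] is forced from [a'], then [a] forces [d] and [c] forces [b]. The
    inequality is tight, 6 <= 6 with an exit and 8 <= 8 without. *)
Lemma affordable_diamond (X U : {set T}) a b c d a' b' :
  inner_closed X -> [disjoint X & U] ->
  U =i [:: a; b; c; d] -> nbhd3 c d a b -> nbhd3 d c a b ->
  nbhd3 a c d a' -> nbhd3 b c d b' -> a' != b -> a' \in X -> affordable X U.
Proof.
move=> cX dXU EU cN dN aN bN nab a'X.
have nba := diamond_end_neq cN dN aN bN nab.
have Ea := diamond_outer cN dN aN nab.
have Eb := diamond_outer (nbhd3R cN) (nbhd3R dN) bN nba.
have [Ec Ed] := (diamond_middle cN dN, diamond_middle dN cN).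
have uU := diamond_uniq cN.
have a'U : a' \notin U by rewrite (disjointFr dXU).
have b'U : b' \notin U.
  have [[_ _ bb'] [_ cb' db']] := nbhd3_neq bN.
  by rewrite EU !inE !negb_or nba ![b' == _]eq_sym bb' cb' db'.
have cU : c \in U by rewrite EU !inE eqxx !orbT.
have dU : d \in U by rewrite EU !inE eqxx !orbT.
rewrite /affordable !(card_set_seq _ EU) // (card_eq_seq EU) //=.
rewrite Ea Eb Ec Ed !in_setU (negPf a'U) (negPf b'U) cU dU a'X.
rewrite (disjointFl dXU cU) (disjointFl dXU dU) /= !orbF.
exists [set c]; rewrite cards1; split; last by case: (b' \in X).
apply: forces_unit cX _ => S cS XS; rewrite sub1set => cS' oS.
have aS : a \in S by rewrite oS ?Ea.
have dS : d \in S.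
  by apply: zf_closed_third cS (nbhd3R aN) aS cS' _; rewrite (subsetP XS).
have bS := zf_closed_third cS cN cS' dS aS.
by apply/subsetP => w; rewrite EU !inE => /or4P[] /eqP->.
Qed.

Lemma affordable_unit (X U : {set T}) u :
  inner_closed X -> unit_shape U -> [disjoint X & U] -> u \in U ->
  outer u \in X -> affordable X U.
Proof.
move=> cX shU dXU; have uX: u \in U -> u \notin X by move=> uU; rewrite (disjointFl dXU).
case: shU => [x y z x' y' z' EU xN yN zN u'
    |a b c d a' b' EU cN dN aN bN nab|a b c d EU aN bN cN dN].
- have [uy uz] := uniq3_perm u'.
  rewrite EU !inE => /or3P[]/eqP->.
  + by rewrite (triangle_outer xN yN zN u'); apply: affordable_triangle xN yN zN u'.
  + rewrite (triangle_outer yN xN (nbhd3C zN) uy).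
    apply: affordable_triangle yN xN (nbhd3C zN) uy => // w.
    by rewrite EU !inE orbCA.
  rewrite (triangle_outer zN (nbhd3C xN) (nbhd3C yN) uz).
  apply: affordable_triangle zN (nbhd3C xN) (nbhd3C yN) uz => // w.
  by rewrite EU !inE orbA orbC.
- have nba := diamond_end_neq cN dN aN bN nab.
  move=> uU; move: (uU); rewrite EU !inE => /or4P[]/eqP Eu; subst u.
  + by rewrite (diamond_outer cN dN aN nab); apply: affordable_diamond cN dN aN bN nab.
  + rewrite (diamond_outer (nbhd3R cN) (nbhd3R dN) bN nba).
    apply: affordable_diamond (nbhd3R cN) (nbhd3R dN) bN aN nba => // w.
    by rewrite EU !inE orbCA.
  + by rewrite (diamond_middle cN dN) (negPf (uX uU)).
  by rewrite (diamond_middle dN cN) (negPf (uX uU)).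
move=> uU; move: (uU); rewrite EU !inE => /or4P[]/eqP Eu; subst u.
- by rewrite (complete_outer aN bN) (negPf (uX uU)).
- by rewrite (complete_outer bN aN) (negPf (uX uU)).
- by rewrite (complete_outer cN (nbhd3C aN)) (negPf (uX uU)).
by rewrite (complete_outer dN (nbhd3C (nbhd3R aN))) (negPf (uX uU)).
Qed.

(** Without an entrance, three blue vertices are used in every shape: 12 is compared with 13 for a
    triangle, and with 12 for a diamond or K4. *)
Lemma first_unit u :
  exists2 A, forces e A (comp u) &
    4 * #|A| <= #|comp u| + 2 * boundary (comp u) + 4 + 4 * (boundary (comp u) == 0).
Proof.
case: (comp_shape u) => [x y z x' y' z' EU xN yN zN u'
    |a b c d a' b' EU cN dN aN bN nab|a b c d EU aN bN cN dN]; rewrite /boundary.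
- have [uy uz] := uniq3_perm u'.
  have [[xy xz xx'] [yz yx' zx']] := nbhd3_neq xN.
  have [[_ _ yy'] [_ xy' zy']] := nbhd3_neq yN.
  have [[_ _ zz'] [_ xz' yz']] := nbhd3_neq zN.
  exists (comp u); first by move=> S.
  have uU : uniq [:: x; y; z] by rewrite /= !inE negb_or xy xz yz.
  rewrite (card_set_seq _ EU) // (card_eq_seq EU) //=.
  rewrite (triangle_outer xN yN zN u') (triangle_outer yN xN (nbhd3C zN) uy).
  rewrite (triangle_outer zN (nbhd3C xN) (nbhd3C yN) uz) !EU !inE !negb_or.
  rewrite ![x' == _]eq_sym ![y' == _]eq_sym ![z' == _]eq_sym.
  by rewrite xx' yx' zx' xy' yy' zy' xz' yz' zz'.
- have nba := diamond_end_neq cN dN aN bN nab.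
  have [[cd ca cb] [da db ab]] := nbhd3_neq cN.
  have [[_ _ aa'] [_ ca' da']] := nbhd3_neq aN.
  have [[_ _ bb'] [_ cb' db']] := nbhd3_neq bN.
  have uU := diamond_uniq cN.
  exists [set w in [:: a; c; d]].
    move=> S AS cS; have A_S w : w \in [:: a; c; d] -> w \in S.
      by move=> wA; rewrite (subsetP AS) // inE.
    have aS : a \in S by rewrite A_S ?inE ?eqxx.
    have cS' : c \in S by rewrite A_S ?inE ?eqxx ?orbT.
    have dS : d \in S by rewrite A_S ?inE ?eqxx ?orbT.
    have bS := zf_closed_third cS cN cS' dS aS.
    by apply/subsetP => w; rewrite EU !inE => /or4P[] /eqP->.
  rewrite (card_set_seq _ EU) // (card_eq_seq EU) //= (card_eq_seq (in_set _)); last first.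
    by rewrite /= !inE !negb_or (eq_sym a c) (eq_sym a d) ca da cd.
  rewrite (diamond_outer cN dN aN nab) (diamond_outer (nbhd3R cN) (nbhd3R dN) bN nba).
  rewrite !EU !inE !negb_or nab nba ![a' == _]eq_sym ![b' == _]eq_sym.
  by rewrite aa' ca' da' bb' cb' db' (diamond_middle cN dN) (diamond_middle dN cN) !eqxx !andbF.
have [[ab ac ad] [bc bd cd]] := nbhd3_neq aN.
exists [set w in [:: a; b; c]].
  move=> S AS cS; have A_S w : w \in [:: a; b; c] -> w \in S.
    by move=> wA; rewrite (subsetP AS) // inE.
  have aS : a \in S by rewrite A_S ?inE ?eqxx.
  have bS : b \in S by rewrite A_S ?inE ?eqxx ?orbT.
  have cS' : c \in S by rewrite A_S ?inE ?eqxx ?orbT.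
  have dS := zf_closed_third cS aN aS bS cS'.
  by apply/subsetP => w; rewrite EU !inE => /or4P[] /eqP->.
rewrite (card_set_seq _ EU) /=; last by case: aN.
rewrite (card_eq_seq (in_set _)) ?(card_eq_seq EU) /=; last 2 first.
- by case: aN.
- by rewrite !inE negb_or ab ac bc.
rewrite (complete_outer aN bN) (complete_outer bN aN).
rewrite (complete_outer cN (nbhd3C aN)) (complete_outer dN (nbhd3C (nbhd3R aN))).
by rewrite !EU !inE !eqxx !orbT.
Qed.

(** * Cuts, and removing units without disconnecting the rest *)

Hypothesis e_2ec : two_edge_connected e.

(** Every edge leaving [L] is outer. With no such edge the graph would be disconnected, and a single
    one would be a bridge. *)
Lemma closed_cut_ge2 L :
  inner_closed L -> L != set0 -> L != setT -> 2 <= boundary L.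
Proof.
move=> cL /set0Pn[x xL]; rewrite -subTset => /subsetPn[y _ yL].
have [_ conn conn2] := e_2ec; rewrite leqNgt ltnS; apply/negP => le1.
rewrite /boundary in le1; set D := [set _ in L | _] in le1.
have exit u v : e u v -> u \in L -> v \notin L -> u \in D /\ v = outer u.
  move=> uv uL vL; case: (adj_outer uv) => [/cL/(_ uL)|Ev]; first by rewrite (negPf vL).
  by rewrite inE uL Ev vL.
have [D0|[z zD]] := set_0Vmem D.
  suff: y \in L by rewrite (negPf yL).
  apply: connect_stable (conn x y) xL => u v uv uL; apply/idPn => /(exit _ _ uv uL).
  by rewrite D0 inE => -[].
have ez : e z (outer z).
  have : outer z != z by move: zD; rewrite inE; apply: contraTneq => ->; case: (z \in L).
  by case/outer_adj/andP.
suff: y \in L by rewrite (negPf yL).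
apply: connect_stable (conn2 _ _ ez x y) xL => u v /andP[uv neq] uL.
apply: contraNT neq => vL; have [uD ->] := exit _ _ uv uL vL.
by rewrite (card_le1_eqP le1 u z uD zD).
Qed.

(* Both the cut around [L] and the cut around [L :|: comp u] would otherwise *)
(* use two vertices of the unit, which has only three exits.                 *)
Lemma comp_not_cut L u :
  inner_closed L -> L != set0 -> u \notin L -> L :|: comp u != setT ->
  exists2 x, x \in L & outer x \notin L :|: comp u.
Proof.
move=> cL nL uL nT; have [x /andP[xL ox]|none] := pickP [pred x | (x \in L) && (outer x \notin L :|: comp u)].
  by exists x.
have {}none x : x \in L -> outer x \in L :|: comp u.
  by move=> xL; have := none x; rewrite /= xL => /negbT/negPn.
have dLu w : w \in comp u -> w \in L -> false.
  rewrite mem_comp => uw wL; have := subsetP (comp_sub cL wL) u uw.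
  by rewrite (negPf uL).
have nLT : L != setT by apply: contraNneq uL => ->; rewrite inE.
have cut1 := closed_cut_ge2 cL nL nLT.
have nLu : L :|: comp u != set0.
  by apply/set0Pn; exists u; rewrite in_setU comp_refl orbT.
have cut2 := closed_cut_ge2 (@compU_closed L u cL) nLu nT.
(* [outer] embeds the exits of [L] into [B1], and the exits of [L :|: comp u] lie in [B2]. These are
   disjoint sets of exits of the unit, so 2 + 2 <= 3. *)
pose B1 := [set w in comp u | outer w \in L].
pose B2 := [set w in comp u | outer w \notin L :|: comp u].
have sub1 : outer @: [set x in L | outer x \notin L] \subset B1.
  apply/subsetP => _ /imsetP[x /setIdP[xL oxL] ->]; rewrite inE outerK xL andbT.
  by have := none x xL; rewrite in_setU (negPf oxL).
have sub2 : [set x in L :|: comp u | outer x \notin L :|: comp u] \subset B2.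
  apply/subsetP => x /setIdP[/setUP[/none->//|xu] ox].
  by apply/setIdP.
have dB : [disjoint B1 & B2].
  rewrite -setI_eq0; apply/eqP/setP => w; rewrite !inE.
  by case: (outer w \in L); rewrite ?andbF.
have sub3 : B1 :|: B2 \subset [set w in comp u | outer w \notin comp u].
  apply/subsetP => w; rewrite in_setU => /orP[] /setIdP[wu ow]; rewrite inE wu /=.
    by apply/negP => /dLu/(_ ow).
  by apply: contraNN ow; rewrite in_setU => ->; rewrite orbT.
have := comp_outer_le3 u; have := subset_leq_card sub3.
have := subset_leq_card sub1; have := subset_leq_card sub2.
rewrite cardsU (disjoint_setI0 dB) cards0 (card_imset _ (inv_inj outerK)).
by move: cut1 cut2; rewrite /boundary; lia.
Qed.

(** For a union of units [C] this is connectedness of the induced subgraph, in terms of cuts; only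
    outer edges can leave an inner-closed [L]. The empty set counts as linked. *)
Definition linked (C : {set T}) : Prop := forall L, inner_closed L ->
  L \subset C -> L != set0 -> L != C -> exists2 x, x \in L & outer x \in C :\: L.

Lemma linked_setC_comp u : linked (~: comp u).
Proof.
move=> L cL LC nL neqL; have uL : u \notin L.
  by apply/negP => /(subsetP LC); rewrite inE comp_refl.
have nT : L :|: comp u != setT.
  apply: contraNneq neqL => LuT; rewrite eqEsubset LC; apply/subsetP => w.
  by rewrite in_setC => /negPf wu; have : w \in setT by []; rewrite -LuT in_setU wu orbF.
have [x xL] := comp_not_cut cL nL uL nT; rewrite in_setU negb_or => /andP[oL ou].
by exists x; rewrite // !in_setD in_setC oL.
Qed.

Definition restr (A : {set T}) : rel T := [rel x y | [&& x \in A, y \in A & e x y]].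

Lemma linked_connect (A : {set T}) t :
  (forall y, y \in A -> connect (restr A) t y) -> linked A.
Proof.
move=> tA L cL LA /set0Pn[y yL] neqL.
have [x /andP[xL ox]|none] := pickP [pred x | (x \in L) && (outer x \in A :\: L)].
  by exists x.
case/negP: neqL; rewrite eqEsubset LA; apply/subsetP => z zA.
have symA : connect_sym (restr A).
  by apply: sym_connect_sym => a b; rewrite /restr /= e_sym andbCA.
have: connect (restr A) y z by rewrite (connect_trans _ (tA z zA)) // symA tA // (subsetP LA).
move/connect_stable; apply => // a b /and3P[aA bA /adj_outer[ab|ab]] aL.
  exact: cL ab aL.
by apply/idPn => bL; have := none a; rewrite /= aL ab inE bL bA.
Qed.

(* Choosing the unit that leaves the largest component around [t] makes its   *)
(* removal from the complement of [X] harmless: a further component would     *)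
(* contain a better choice.                                                   *)
Lemma next_unit X t :
  inner_closed X -> X != set0 -> linked (~: X) -> t \notin X ->
  X :|: comp t != setT ->
  exists u, [/\ u \notin X, outer u \in X, t \notin comp u & linked (~: (X :|: comp u))].
Proof.
move=> cX nX lX tX nT; pose A u := ~: (X :|: comp u).
pose K u := [set y | connect (restr (A u)) t y].
pose P u := [&& u \notin X, outer u \in X & t \notin comp u].
(* A first candidate: [X] has an outer edge to a unit other than that of [t]. *)
have [x xX] := comp_not_cut cX nX tX nT.
rewrite in_setU negb_or => /andP[oxX oxt].
have P0 : P (outer x) by rewrite /P oxX outerK xX mem_comp.
case: (arg_maxnP (fun u => #|K u|) P0) => u /and3P[uX ouX tu] umax.
exists u; split=> //; apply: (@linked_connect _ t) => y yA; apply/idPn => yK.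
have cA w : inner_closed (A w) by apply/setC_closed/compU_closed.
have tA : t \in A u by rewrite !in_setC in_setU negb_or tX.
have tK : t \in K u by rewrite inE connect0.
have KA : K u \subset A u.
  apply/subsetP => w; rewrite inE => /connect_stable; apply=> // a b.
  by case/and3P.
have Kstep a b : a \in K u -> b \in A u -> e a b -> b \in K u.
  move=> aK bA ab; move: (aK); rewrite !inE => /connect_trans->//.
  by apply/connect1/and3P; rewrite (subsetP KA _ aK).
have cK : inner_closed (K u).
  move=> a b ab aK; apply: Kstep (aK) _ (inner_adj ab).
  exact: cA ab (subsetP KA _ aK).
(* The part that removing [comp u] would separate from [t]. *)
pose L := A u :\: K u.
have cL : inner_closed L.
  move=> a b ab /setDP[aA aK]; rewrite inE (cA u _ _ ab aA) andbT.
  by apply: contraNN aK; apply: cK; rewrite inner_sym.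
have nL : L != set0 by apply/set0Pn; exists y; rewrite inE yA inE yK.
have uL : u \notin L by rewrite in_setD in_setC in_setU comp_refl orbT andbF.
have nLT : L :|: comp u != setT.
  by rewrite -subTset; apply/subsetPn; exists t; rewrite // in_setU in_setD tK (negPf tu).
(* [L] has an outer edge avoiding [comp u]. It cannot end in [K u], which is a full component, so it
   ends in [X], and [w] is a candidate as well. *)
have [w wL] := comp_not_cut cL nL uL nLT; rewrite in_setU negb_or => /andP[owL owu].
have /setDP[wA wK] := wL.
have eow : e (outer w) w.
  rewrite e_sym; have /outer_adj/andP[] // : outer w != w.
  by apply: contraNneq owL => ->.
have owX : outer w \in X.
  move: owL; rewrite in_setD negb_and in_setC in_setU (negPf owu) orbF !negbK.
  by case/orP=> // owK; case/negP: wK; apply: Kstep owK wA eow.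
have wX : w \notin X by move: wA; rewrite in_setC in_setU negb_or => /andP[].
have cwL : comp w \subset L by apply: comp_sub.
have Pw : P w.
  rewrite /P wX owX; apply: contraTN tK => tw.
  by have /setDP[_] := subsetP cwL t tw.
have Aw a : a \notin X -> a \notin L -> a \in A w.
  move=> aX aL; rewrite in_setC in_setU negb_or aX.
  by apply: contraNN aL; apply: (subsetP cwL).
have KL a : a \in K u -> a \notin L by move=> aK; rewrite in_setD aK.
have KX a : a \in K u -> a \notin X.
  by move/(subsetP KA); rewrite in_setC in_setU negb_or => /andP[].
have KKw : K u \subset K w.
  apply/subsetP => z; rewrite inE => tz.
  suff: z \in K u :&: K w by case/setIP.
  apply: connect_stable tz _ => [a b /and3P[aA bA ab] /setIP[aK aKw]|].
    have bK := Kstep _ _ aK bA ab; rewrite in_setI bK inE.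
    move: aKw; rewrite inE => /connect_trans-> //; apply/connect1/and3P.
    by rewrite !Aw ?KL ?KX.
  by rewrite in_setI tK inE connect0.
(* As the complement of [X] is linked, an outer edge joins [K u] to the rest of it, necessarily to
   [comp u]. Removing [comp w], which lies in [L], keeps this edge, so [K w] is strictly larger than
   [K u]. *)
have [|||v vK] := lX (K u) cK.
- by apply/subsetP => a /KX; rewrite in_setC.
- by apply/set0Pn; exists t.
- by apply: contraNneq wK => ->; rewrite in_setC.
rewrite in_setD in_setC => /andP[ovK ovX].
have ev : e v (outer v).
  by have /outer_adj/andP[] // : outer v != v; apply: contraNneq ovK => ->.
have ovA : outer v \notin A u by apply: contraNN ovK => ovA; apply: Kstep vK ovA ev.
have ovKw : outer v \in K w.
  have := subsetP KKw _ vK; rewrite !inE => /connect_trans-> //.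
  apply/connect1/and3P; rewrite !Aw ?(KL v) ?(KX v) //.
  by rewrite in_setD (negPf ovA) andbF.
have /umax := Pw; rewrite /= leqNgt => /negP[]; apply: proper_card.
by apply/properP; split=> //; exists (outer v).
Qed.

(** * Colouring the units one after another within the budget *)

Definition extendable (X : {set T}) : Prop :=
  [/\ inner_closed X, X != set0, linked (~: X) &
    exists2 B, forces e B X &
      4 * #|B| <= #|X| + 2 * boundary X + 4 + 4 * (boundary X == 0)].

(** [outer] matches the exits of [X] into [U] with the entrances of [U] from [X]; all other exits
    survive in the union. *)
Lemma boundaryU (X U : {set T}) : [disjoint X & U] ->
  boundary (X :|: U) + #|[set w in U | outer w \in X]|
    = boundary X + #|[set w in U | outer w \notin X :|: U]|.
Proof.
move=> dXU; rewrite /boundary.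
have dis w : w \in X -> w \in U -> False by move=> wX; rewrite (disjointFr dXU wX).
have -> : [set x in X :|: U | outer x \notin X :|: U] =
    [set x in X | outer x \notin X :|: U] :|: [set w in U | outer w \notin X :|: U].
  by apply/setP => x; rewrite !inE andb_orl.
have -> : [set x in X | outer x \notin X] =
    [set x in X | outer x \notin X :|: U] :|: [set x in X | outer x \in U].
  apply/setP => x; rewrite !inE -andb_orr; congr (_ && _).
  case oX: (outer x \in X) => /=; last by rewrite orNb.
  by apply/esym/negP => /(dis _ oX).
have -> : [set w in U | outer w \in X] = outer @: [set x in X | outer x \in U].
  apply/setP => w; apply/idP/imsetP => [|[x]]; rewrite inE => /andP[wU owX].
    by exists (outer w); rewrite ?outerK // inE owX outerK.
  by move=> ->; rewrite inE outerK owX wU.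
rewrite (card_imset _ (inv_inj outerK)) !cardsU.
set Y := [set x in X | _]; set V := [set w in U | _]; set Z := [set x in X | _].
have -> : Y :&: V = set0.
  by apply/setP => x; rewrite !inE; apply/negP => /andP[/andP[/dis xU _] /andP[/xU]].
have -> : Y :&: Z = set0.
  by apply/setP => x; rewrite !inE; case: (outer x \in U); rewrite ?orbT ?andbF.
by rewrite cards0 !subn0 addnAC.
Qed.

Lemma extend_step X : extendable X -> X != setT ->
  exists2 X', extendable X' & X \proper X'.
Proof.
move=> [cX nX lX [B BX leB]] nT.
have bX := closed_cut_ge2 cX nX nT.
have [u [uX ouX lXu exitu]] : exists u, [/\ u \notin X, outer u \in X,
    linked (~: (X :|: comp u)) & X :|: comp u = setT \/
    0 < #|[set w in comp u | outer w \notin X :|: comp u]|].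
  have /subsetPn[t _ tX] : ~~ (setT \subset X) by rewrite subTset.
  (* A single unit remains; it is entered through any exit of [X]. *)
  have [XtT|nXt] := eqVneq (X :|: comp t) setT.
    have /card_gt0P[x] := ltnW bX; rewrite inE => /andP[xX oxX].
    have oxt : outer x \in comp t.
      by have : outer x \in setT by []; rewrite -XtT in_setU (negPf oxX).
    have EU : X :|: comp (outer x) = setT.
      apply/eqP; rewrite -subTset -XtT setUS // comp_sub //; first exact: comp_closed.
      by rewrite mem_comp.
    exists (outer x); rewrite outerK; split=> //; last by left.
    by move=> L _; rewrite EU setCT subset0 => /eqP-> /eqP.
  have [u [uX ouX tu lXu]] := next_unit cX nX lX tX nXt; exists u; split=> //.
  (* The new unit is a proper part of the linked complement, because it misses [t]; hence it has an
     exit. *)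
  right; have uCX : comp u \subset ~: X.
    by apply: comp_sub; [apply: setC_closed | rewrite in_setC].
  have [||w wu] := lX (comp u) (@comp_closed u) uCX.
  - by apply/set0Pn; exists u; apply: comp_refl.
  - by apply: contraNneq tu => ->; rewrite in_setC.
  rewrite in_setD in_setC => /andP[owu owX]; apply/card_gt0P; exists w.
  by rewrite inE wu in_setU negb_or owX.
have dXu : [disjoint X & comp u].
  rewrite disjoints_subset subsetC comp_sub ?in_setC //; exact: setC_closed.
have [A [forceA leA]] := affordable_unit cX (comp_shape u) dXu (comp_refl u) ouX.
exists (X :|: comp u); last first.
  by apply/properP; split; [exact: subsetUl | exists u; rewrite // in_setU comp_refl orbT].
split=> //; first exact: compU_closed.
  by apply/set0Pn; exists u; rewrite in_setU comp_refl orbT.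
exists (B :|: A); first exact: forceA.
have := boundaryU dXu; have := (leq_card_setU B A).1.
have -> : #|X :|: comp u| = #|X| + #|comp u|.
  by rewrite cardsU (disjoint_setI0 dXu) cards0 subn0.
(* The bonus of 4 for a unit without exits is thus spent only when the new boundary is 0, where the
   invariant grants it; the old boundary is at least 2, so it has not been spent before. *)
have : (boundary (X :|: comp u) = 0) \/
    0 < #|[set w in comp u | outer w \notin X :|: comp u]|.
  case: exitu => [->|]; [left|by right].
  by apply/eqP; rewrite cards_eq0; apply/eqP/setP => x; rewrite !inE.
move: leA leB bX; move: (boundary _) (boundary _) => b b'.
move: #|[set _ in _ | outer _ \in _]| #|[set _ in _ | outer _ \notin _]| => i o.
lia.
Qed.

(** Starting from one unit, [X] is extended until it is everything. The boundary is then 0, and the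
    two allowances of 4, for the first and the last unit, give the 8. *)
Lemma zf_number_le : 4 * zf_number e <= #|T| + 8.
Proof.
have all_blue X : extendable X -> exists2 B, forces e B setT & 4 * #|B| <= #|T| + 8.
  have [n] := ubnP (#|T| - #|X|); elim: n X => // n IHn X leXn extX.
  have [XT|/(extend_step extX)[X' extX' ltX]] := eqVneq X setT.
    have [_ _ _ [B BX leB]] := extX; exists B; rewrite -?XT //.
    have b0 : boundary X = 0.
      by rewrite XT; apply/eqP; rewrite cards_eq0; apply/eqP/setP => x; rewrite !inE.
    by move: leB; rewrite b0 XT cardsT; lia.
  apply: IHn extX'; have := proper_card ltX; have := subset_leq_card (subsetT X'); rewrite cardsT.
  by move: leXn; rewrite ltnS; lia.
have [T_gt1 _ _] := e_2ec; have /card_gt0P[u _] := ltnW T_gt1.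
have [|B /forces_forcing_set/forcing_number_le leB] := all_blue (comp u); last first.
  by apply: leq_trans; rewrite leq_mul2l.
split; [exact: comp_closed | by apply/set0Pn; exists u; apply: comp_refl
       | exact: linked_setC_comp | exact: first_unit].
Qed.

End ClawFreeCubic.

(** * The lower bound for rings of diamonds *)

Lemma loop_zf_ruleP (T : finType) (e : rel T) (S : {set T}) w :
  loop_zf_rule e S w ->
  (exists v, [/\ v \in S, e v w & forall y, e v y -> y != w -> y \in S]) \/
  (forall y, e w y -> y \in S).
Proof.
case/orP=> [/exists_inP[v vS /eqP Ew]|/andP[_ /subsetP wN]]; last first.
  by right=> y wy; apply: wN; rewrite inE.
left; exists v; have := set11 w; rewrite -Ew inE => /andP[_]; rewrite inE => vw.
split=> // y vy; apply: contraNT => yS.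
by rewrite -in_set1 -Ew !inE yS.
Qed.

Section RingOfDiamonds.

Variables (T : finType) (e : rel T) (k : nat).
Variables (D : 'I_k -> {set T}) (a b : 'I_k -> T).
Hypotheses (e_sym : symmetric e) (k_ge2 : 2 <= k).
Hypothesis D_disj : forall i j, i != j -> [disjoint D i & D j].
Hypothesis D_cover : \bigcup_i D i = [set: T].
Hypothesis D_diamond : forall i, diamond e (D i) (a i) (b i).
Hypothesis D_links : forall i j x y, i != j -> x \in D i -> y \in D j ->
  e x y = [exists l, [set x; y] == [set b l; a (ordS l)]].

Definition middle i := D i :\: [set a i; b i].

Lemma D_index x : exists i, x \in D i.
Proof.
have : x \in \bigcup_i D i by rewrite D_cover.
by case/bigcupP=> i _ xD; exists i.
Qed.

Lemma D_index_eq x i j : x \in D i -> x \in D j -> i = j.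
Proof.
by move=> xi xj; apply/eqP/idPn => /D_disj/disjointFr/(_ xi); rewrite xj.
Qed.

Lemma a_in i : a i \in D i. Proof. by case: (D_diamond i). Qed.
Lemma b_in i : b i \in D i. Proof. by case: (D_diamond i). Qed.

Lemma card_middle i : #|middle i| = 2.
Proof.
have [D4 aD bD ab _] := D_diamond i.
rewrite cardsD (setIidPr _) ?D4 ?cards2 ?ab //.
by apply/subsetP => x /set2P[]->.
Qed.

Lemma middle_in i x : x \in middle i -> x \in D i.
Proof. by case/setDP. Qed.

(** Edges between diamonds join ends only, so the closed neighbourhood of a middle vertex is its
    diamond; in particular the two middle vertices are twins. *)
Lemma middle_adj i x y : x \in middle i -> e x y = (y \in D i) && (x != y).
Proof.
case/setDP=> xD; rewrite !inE => nab; have [j yD] := D_index y.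
have [Ej|neq] := eqVneq i j.
  subst j; have [_ _ _ _ ->] := D_diamond i => //; rewrite yD /= andbC.
  case: eqP => //= Exy; case/negP: nab.
  by have := set21 x y; rewrite Exy !inE.
rewrite (D_links neq xD yD) (disjointFl (D_disj neq) yD) /=.
apply/existsP => -[l /eqP Exy]; case/negP: nab.
have := set21 x y; rewrite Exy => /set2P[] Ex; subst x.
  by rewrite (D_index_eq xD (b_in l)) eqxx orbT.
by rewrite (D_index_eq xD (a_in (ordS l))) eqxx.
Qed.

Lemma ordS_neq (i : 'I_k) : ordS i != i.
Proof.
apply/eqP => /(congr1 val) /=; have [lt|ge] := ltnP i.+1 k.
  by rewrite modn_small //; lia.
have -> : i.+1 = k by apply/eqP; rewrite eqn_leq ge ltn_ord.
by rewrite modnn; have := ltn_ord i; lia.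
Qed.

Lemma end_adj i v : v \in D i -> v \notin middle i ->
  exists j u, [/\ j != i, u \in D j, u \notin middle j, e v u &
    {in middle i, forall y, e v y}].
Proof.
move=> vD vM.
have vm : {in middle i, forall y, e v y}.
  by move=> y yM; rewrite e_sym (middle_adj _ yM) vD; apply: contraNneq vM => <-.
move: (vM); rewrite inE vD andbT negbK => /set2P[] Ev; subst v.
  exists (ord_pred i), (b (ord_pred i)); have neq : ord_pred i != i.
    by have := ordS_neq (ord_pred i); rewrite ord_predK eq_sym.
  split=> //; rewrite ?b_in // ?inE ?eqxx ?orbT //.
  rewrite e_sym (D_links neq (b_in _) (a_in i)); apply/existsP.
  by exists (ord_pred i); rewrite ord_predK.
exists (ordS i), (a (ordS i)); have neq := ordS_neq i.
split=> //; rewrite ?a_in // ?inE ?eqxx //.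
by rewrite (D_links _ (b_in i) (a_in _)) 1?eq_sym //; apply/existsP; exists i.
Qed.

(** While both twins are white neither can turn blue: a neighbour of one that is blue sees the other
    as a second white neighbour, and each twin has the other as a white neighbour. *)
Lemma middle_meets i (S : {set T}) :
  forcing_set (loop_zf_rule e) S -> exists2 m, m \in middle i & m \in S.
Proof.
move=> S_T; have [m /andP[]|none] := pickP [pred m | (m \in middle i) && (m \in S)].
  by exists m.
have dS : [disjoint middle i & S].
  by apply/pred0P => m; have := none m.
suff: [disjoint middle i & [set: T]].
  by rewrite -setI_eq0 setIT -cards_eq0 card_middle.
suff: setT \in [set S' : {set T} | [disjoint middle i & S']] by rewrite inE.
apply: connect_stable S_T _; last by rewrite inE.
move=> S1 S2 /existsP[w /andP[rule_w /eqP->]]; rewrite !inE => dS1.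
rewrite disjoints_subset; apply/subsetP => x xM.
rewrite in_setC in_setU1 (disjointFr dS1 xM) orbF; apply/eqP => Ex; subst x.
rename xM into wM; have /card_gt0P[m] : 0 < #|middle i :\ w|.
  by have := cardsD1 w (middle i); rewrite wM card_middle; lia.
case/setD1P=> mw mM; have mS := disjointFr dS1 mM.
case: (loop_zf_ruleP rule_w) => [[v [vS vw others]]|all_blue].
  have := vw; rewrite e_sym (middle_adj _ wM) => /andP[vD _].
  have mv : m != v by apply: contraFneq mS => ->.
  by have := others m; rewrite mS mw e_sym (middle_adj _ mM) vD mv => /(_ isT isT).
by have := all_blue m; rewrite mS (middle_adj _ wM) (middle_in mM) eq_sym mw => /(_ isT).
Qed.

Lemma card_blue (S : {set T}) : #|S| = \sum_i #|S :&: D i|.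
Proof.
rewrite -sum1_card -[S in LHS]setIT -D_cover big_distrr /=.
rewrite partition_disjoint_bigcup => [|i j /D_disj].
  by apply: eq_bigr => i _; rewrite sum1_card.
  exact: disjointW (subsetIr _ _) (subsetIr _ _).
Qed.

(** Each diamond holds a blue middle vertex, so it suffices to find one diamond with three blue
    vertices or two diamonds with two each. The first move always exhibits one of these. *)
Lemma loop_forcing_set_ge (S : {set T}) :
  forcing_set (loop_zf_rule e) S -> k + 2 <= #|S|.
Proof.
move=> S_T; have meets i := middle_meets i S_T.
have ge1 i : 0 < #|S :&: D i|.
  by have [m /middle_in mD mS] := meets i; apply/card_gt0P; exists m; rewrite inE mS.
have split_sum : #|S| = k + \sum_i (#|S :&: D i| - 1).
  have Ek : k = \sum_(i < k) 1 by rewrite sum1_card card_ord.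
  rewrite card_blue [X in _ = X + _]Ek -big_split /=.
  by apply: eq_bigr => i _; rewrite subnKC.
have three i : 3 <= #|S :&: D i| -> k + 2 <= #|S|.
  by move=> ge3; rewrite split_sum leq_add2l (bigD1 i) //=; lia.
have two i j : j != i -> 2 <= #|S :&: D i| -> 2 <= #|S :&: D j| -> k + 2 <= #|S|.
  by move=> nij ge2i ge2j; rewrite split_sum leq_add2l (bigD1 i) //= (bigD1 j) //=; lia.
have end2 i v : v \in D i -> v \notin middle i -> v \in S -> 2 <= #|S :&: D i|.
  move=> vD vM vS; have [m mM mS] := meets i.
  apply/card_gt1P; exists v, m; rewrite !inE vS vD mS (middle_in mM); split=> //.
  by apply: contraNneq vM => ->.
have card3 i w : D i :\ w \subset S -> k + 2 <= #|S|.
  move=> DwS; apply: (three i); have [D4 _ _ _ _] := D_diamond i.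
  have : #|D i :\ w| <= #|S :&: D i|.
    by apply: subset_leq_card; rewrite subsetI DwS subsetDl.
  by have := cardsD1 w (D i); rewrite D4; case: (w \in D i) => /=; lia.
(* If there is no move, [S] is the whole vertex set and any diamond will do. *)
have /connectP[[|S1 p] /=] := S_T.
  move=> _ ST; have k_gt0 := ltnW k_ge2.
  by apply: (card3 (Ordinal k_gt0) (a (Ordinal k_gt0))); rewrite -ST subsetT.
case/andP=> /existsP[w /andP[rule_w _]] _ _.
case: (loop_zf_ruleP rule_w) => [[v [vS _ others]]|all_blue]; last first.
  have [i wD] := D_index w; have [wM|wM] := boolP (w \in middle i).
    apply: (card3 i w); apply/subsetP => y /setD1P[yw yD].
    by apply: all_blue; rewrite (middle_adj _ wM) yD eq_sym.
  have [j [u [ji uD uM wu wm]]] := end_adj wD wM.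
  apply: (two i j ji); last by apply: end2 uD uM (all_blue _ wu).
  rewrite -(card_middle i); apply/subset_leq_card/subsetP => y yM.
  by rewrite inE (middle_in yM) all_blue ?wm.
have [i vD] := D_index v; have [vM|vM] := boolP (v \in middle i).
  apply: (card3 i w); apply/subsetP => y /setD1P[yw yD].
  have [<-//|vy] := eqVneq v y; apply: others => //.
  by rewrite (middle_adj _ vM) yD.
have [j [u [ji uD uM vu vm]]] := end_adj vD vM.
(* The forcing vertex [v] is an end. If it forces inside its diamond, its partner [u] in the next
   diamond is also a blue end, and each of the two diamonds has a blue middle vertex too; if it
   forces [u], then [v] and both middle vertices are blue. *)
have [Ew|uw] := eqVneq u w; last first.
  apply: (two i j ji); first exact: end2 vD vM vS.
  exact: end2 uD uM (others _ vu uw).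
subst w; apply: (three i).
have <- : #|v |: middle i| = 3 by rewrite cardsU1 vM card_middle.
apply/subset_leq_card/subsetP => y /setU1P[->|yM]; first by rewrite inE vS.
rewrite inE (middle_in yM) andbT others ?vm //.
by apply: contraNneq ji => Ey; apply/eqP/(D_index_eq uD)/middle_in; rewrite -Ey.
Qed.

Lemma card_ring : #|T| = 4 * k.
Proof.
rewrite -cardsT card_blue mulnC -[in RHS](card_ord k) -sum_nat_const.
by apply: eq_bigr => i _; rewrite setTI; case: (D_diamond i).
Qed.

End RingOfDiamonds.

(** * Rounding, and the two bounds combined *)

Lemma ceil_bound (z n : nat) : 0 < n -> 4 * z <= n + 8 ->
  (z%:Z <= Num.ceil ((5 * n)%:R / 18%:R : rat) + 1)%R.
Proof.
move=> n_gt0 le_z; set x : rat := ((5 * n)%:R / 18%:R)%R; set c := Num.ceil x.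
have : ((5 * n)%:Z%:~R <= (18 * c)%:~R :> rat)%R.
  by rewrite [leRHS]intrM mulrC -ler_pdivrMr //; apply: ceil_ge.
(* Since [n] is positive, z - 2 <= n/4 < 5n/18 <= c, and strictness between integers gives z <= c +
   1. *)
by rewrite ler_int; lia.
Qed.

Theorem theorem1p1 (T : finType) (e : rel T)
    (e_sym : symmetric e) (e_irr : irreflexive e)
    (e_2ec : two_edge_connected e) (e_cf : claw_free e) (e_cubic : cubic e) :
  (~ ring_of_diamonds e ->
     loop_zf_number e <= zf_number e /\
     ((zf_number e)%:Z <= Num.ceil ((5 * #|T|)%:R / 18%:R : rat) + 1)%R) /\
  (ring_of_diamonds e ->
     loop_zf_number e = zf_number e /\ ((zf_number e)%:R = #|T|%:R / 4%:R + 2%:R :> rat)%R).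
Proof.
have le_loop := loop_zf_number_le e.
have le_zf := zf_number_le e_sym e_irr e_cf e_cubic e_2ec.
split=> [_|[k [D [a [b [k_ge2 D_disj D_cover D_diamond D_links]]]]]].
  by split=> //; apply: ceil_bound => //; case: e_2ec => T_gt1 _ _; apply: ltnW.
have ge_loop : k + 2 <= loop_zf_number e.
  rewrite /loop_zf_number; have [S S_T ->] := forcing_numberP (loop_zf_rule e).
  exact: (loop_forcing_set_ge e_sym k_ge2 D_disj D_cover D_diamond D_links).
have cardT := card_ring D_disj D_cover D_diamond.
(* With [4 * k] vertices the general upper bound is [k + 2], which meets the lower bound on the loop
   number. *)
have Ezf : zf_number e = k + 2 by lia.
split; first by lia.
by rewrite Ezf cardT natrD natrM mulrC mulKf.
Qed.
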